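(* Let $d,K\ge 1$ be integers, $\mathbb X\subseteq\mathbb R^d$, $x_0\in\mathbb R^d$, $\delta\ge 0$, and let $c:\mathbb R^d\times\mathbb R^d\to[0,\infty)$ be continuous. For each $k\in\{1,\dots,K\}$ let $\hat\theta_k\in\mathbb R^d$, let $\hat\Sigma_k$ be a symmetric positive definite $d\times d$ matrix, and let $\rho_k\ge 0$. Then the problem $$\min_{x\in\mathbb X}\ \max_{k\in\{1,\dots,K\}}\ \sup_{\mathbb Q_k\in\mathcal B_k(\hat{\mathbb P}_k)}\mathbb Q_k(\tilde\theta^\top x\le 0)\quad\text{s.t.}\quad c(x,x_0)\le\delta,\quad \sup_{\mathbb Q_k\in\mathcal B_k(\hat{\mathbb P}_k)}\mathbb Q_k(\tilde\theta^\top x\le 0)<1\ \ \forall k\in\{1,\dots,K\}$$ is equivalent to $$\min_{x\in\mathcal X}\ \max_{k\in\{1,\dots,K\}}\ \frac{\rho_k\,\hat\theta_k^\top x\,\|x\|_2+\sqrt{x^\top\hat\Sigma_k x}\,\sqrt{(\hat\theta_k^\top x)^2+x^\top\hat\Sigma_k x-\rho_k^2\|x\|_2^2}}{(\hat\theta_k^\top x)^2+x^\top\hat\Sigma_k x},$$ where $$\mathcal X=\left\{x\in\mathbb X:\ c(x,x_0)\le\delta,\ \ -\hat\theta_k^\top x+\rho_k\|x\|_2<0\ \ \forall k\in\{1,\dots,K\}\right\}.$$ Here equivalence means that the two problems have the same feasible set and the same set of optimal solutions.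
   Context: $\tilde\theta$ denotes a random vector in $\mathbb R^d$ (the identity map on $\mathbb R^d$ under a probability distribution on $\mathbb R^d$); it is the parameter of a linear classifier, and the event that $x$ receives the unfavorable label is identified with $\{\tilde\theta^\top x\le 0\}$. Gelbrich distance: for $(\theta,\Sigma),(\hat\theta,\hat\Sigma)\in\mathbb R^d\times\mathbb S_+^d$ ($\mathbb S_+^d$ is the set of symmetric positive semidefinite $d\times d$ matrices), $$\mathbb G((\theta,\Sigma),(\hat\theta,\hat\Sigma))=\sqrt{\|\theta-\hat\theta\|_2^2+\mathrm{Tr}\big[\Sigma+\hat\Sigma-2(\hat\Sigma^{1/2}\Sigma\hat\Sigma^{1/2})^{1/2}\big]}.$$ Write $\mathbb Q_k\sim(\theta_k,\Sigma_k)$ if the probability distribution $\mathbb Q_k$ on $\mathbb R^d$ has mean $\theta_k$ and covariance matrix $\Sigma_k$. The nominal component $\hat{\mathbb P}_k$ has mean $\hat\theta_k$ and covariance $\hat\Sigma_k$, and $$\mathcal B_k(\hat{\mathbb P}_k)=\{\mathbb Q_k:\ \mathbb Q_k\sim(\theta_k,\Sigma_k),\ \mathbb G((\theta_k,\Sigma_k),(\hat\theta_k,\hat\Sigma_k))\le\rho_k\},$$ with no parametric form imposed on $\mathbb Q_k$. *)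

(* Defs.v *)
From HB Require Import structures.
From mathcomp Require Import all_boot all_order all_algebra.
From mathcomp Require Import all_classical all_reals all_analysis.
Import Order.TTheory GRing.Theory Num.Theory.
Import numFieldNormedType.Exports.

Set Implicit Arguments.
Unset Strict Implicit.
Unset Printing Implicit Defensive.

Local Open Scope classical_set_scope.
Local Open Scope ring_scope.

Definition dotv (R : realType) (d : nat) (u v : 'cV[R]_d) : R :=
  (u^T *m v) 0 0.

(* MathComp-Analysis's `|x| on matrices is the sup norm, hence this one. *)
Definition norm2 (R : realType) (d : nat) (x : 'cV[R]_d) : R :=
  Num.sqrt (\sum_i x i 0 ^+ 2).

Definition quadf (R : realType) (d : nat) (S : 'M[R]_d) (x : 'cV[R]_d) : R :=
  (x^T *m S *m x) 0 0.

Definition is_psd (R : realType) (d : nat) (S : 'M[R]_d) : Prop :=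
  S^T = S /\ forall v : 'cV[R]_d, 0 <= quadf S v.

Definition is_pd (R : realType) (d : nat) (S : 'M[R]_d) : Prop :=
  S^T = S /\ forall v : 'cV[R]_d, v != 0 -> 0 < quadf S v.

(* The positive semidefinite square root, which exists and is unique when S is
   positive semidefinite; the default value 0 is only taken for other S. *)
Definition psd_sqrt (R : realType) (d : nat) (S : 'M[R]_d) : 'M[R]_d :=
  xget 0 [set B : 'M[R]_d | is_psd B /\ B *m B = S].

Definition gelbrich (R : realType) (d : nat) (theta : 'cV[R]_d)
    (Sigma : 'M[R]_d) (thetah : 'cV[R]_d) (Sigmah : 'M[R]_d) : R :=
  Num.sqrt (norm2 (theta - thetah) ^+ 2 +
    \tr (Sigma + Sigmah -
         2 *: psd_sqrt (psd_sqrt Sigmah *m Sigma *m psd_sqrt Sigmah))).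

(* R^d with its Borel sigma-algebra. *)
Definition borelV (R : realType) (d : nat) :=
  g_sigma_algebraType (@open 'cV[R]_d).

Definition coordf (R : realType) (d : nat) (i : 'I_d) : borelV R d -> R :=
  fun t => (t : 'cV[R]_d) i 0.

(* Finiteness of the second moments is what makes the mean and the covariance
   matrix meaningful: a divergent integral has a junk value in the library. *)
Definition has_moments (R : realType) (d : nat) (Q : probability (borelV R d) R)
    (theta : 'cV[R]_d) (Sigma : 'M[R]_d) : Prop :=
  [/\ forall i, coordf i \in Lfun Q 2%:E,
      forall i, expectation Q (coordf i) = (theta i 0)%:E &
      forall i j, covariance Q (coordf i) (coordf j) = (Sigma i j)%:E].

(* The ball around a nominal distribution depends on the latter only through
   its mean thetah and its covariance matrix Sigmah. *)
Definition gelbrich_ball (R : realType) (d : nat) (thetah : 'cV[R]_d)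
    (Sigmah : 'M[R]_d) (rho : R) : set (probability (borelV R d) R) :=
  [set Q | exists (theta : 'cV[R]_d) (Sigma : 'M[R]_d),
      has_moments Q theta Sigma /\
      gelbrich theta Sigma thetah Sigmah <= rho].

Definition unfavorable (R : realType) (d : nat) (x : 'cV[R]_d) :
    set (borelV R d) :=
  [set theta : borelV R d | dotv (theta : 'cV[R]_d) x <= 0].

Definition worst_case_prob (R : realType) (d : nat) (thetah : 'cV[R]_d)
    (Sigmah : 'M[R]_d) (rho : R) (x : 'cV[R]_d) : \bar R :=
  ereal_sup [set Q (unfavorable x) | Q in gelbrich_ball thetah Sigmah rho].

Definition robust_feasible (R : realType) (d K : nat) (X : set 'cV[R]_d)
    (x0 : 'cV[R]_d) (delta : R) (c : 'cV[R]_d -> 'cV[R]_d -> R)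
    (thetah : 'I_K -> 'cV[R]_d) (Sigmah : 'I_K -> 'M[R]_d) (rho : 'I_K -> R) :
    set 'cV[R]_d :=
  [set x | [/\ X x, c x x0 <= delta &
    forall k, (worst_case_prob (thetah k) (Sigmah k) (rho k) x < 1)%E]].

Definition robust_objective (R : realType) (d K : nat)
    (thetah : 'I_K -> 'cV[R]_d) (Sigmah : 'I_K -> 'M[R]_d) (rho : 'I_K -> R)
    (x : 'cV[R]_d) : \bar R :=
  \big[maxe/-oo%E]_(k < K) worst_case_prob (thetah k) (Sigmah k) (rho k) x.

Definition explicit_feasible (R : realType) (d K : nat) (X : set 'cV[R]_d)
    (x0 : 'cV[R]_d) (delta : R) (c : 'cV[R]_d -> 'cV[R]_d -> R)
    (thetah : 'I_K -> 'cV[R]_d) (rho : 'I_K -> R) : set 'cV[R]_d :=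
  [set x | [/\ X x, c x x0 <= delta &
    forall k, - dotv (thetah k) x + rho k * norm2 x < 0]].

Definition explicit_ratio (R : realType) (d : nat) (thetah : 'cV[R]_d)
    (Sigmah : 'M[R]_d) (rho : R) (x : 'cV[R]_d) : R :=
  (rho * dotv thetah x * norm2 x +
   Num.sqrt (quadf Sigmah x) *
     Num.sqrt (dotv thetah x ^+ 2 + quadf Sigmah x - rho ^+ 2 * norm2 x ^+ 2))
  / (dotv thetah x ^+ 2 + quadf Sigmah x).

Definition explicit_objective (R : realType) (d K : nat)
    (thetah : 'I_K -> 'cV[R]_d) (Sigmah : 'I_K -> 'M[R]_d) (rho : 'I_K -> R)
    (x : 'cV[R]_d) : \bar R :=
  \big[maxe/-oo%E]_(k < K) (explicit_ratio (thetah k) (Sigmah k) (rho k) x)%:E.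

Definition argmin (R : realType) (T : Type) (F : set T) (f : T -> \bar R) :
    set T :=
  [set x | F x /\ forall y, F y -> (f x <= f y)%E].

(* Main.v *)
(* Fix a component and put m = thetah^T x, s = sqrt (x^T Sigmah x), r = rho |x|.
   A distribution with moments (theta, Sigma) matters only through
   mu = theta^T x and sigma = sqrt (x^T Sigma x), and the Gelbrich ball projects
   exactly onto the half disc (mu - m)^2 + (sigma - s)^2 <= r^2, sigma >= 0: one
   inclusion comes from the optimal transport map between the centred Gaussians,
   the other from rank-one perturbations of the nominal moments along x.  By
   Cantelli's inequality, sharp for a two-point law along x, the worst-case
   probability given mu > 0 is sigma^2 / (sigma^2 + mu^2), and it is 1 when
   mu <= 0 is allowed, i.e. when m <= r.  If m > r, the maximum over the disc is
   reached at the tangent from the origin, and equals the square of the explicit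
   ratio, which lies in (0, 1); squaring does not change the minimizers. *)
Require Import Defs.
From HB Require Import structures.
From mathcomp Require Import all_boot all_order all_algebra.
From mathcomp Require Import all_classical all_reals all_analysis.
From mathcomp Require Import measurable_realfun.
From mathcomp Require Import ring lra.
Import Order.TTheory GRing.Theory Num.Theory.
Import numFieldNormedType.Exports.

Set Implicit Arguments.
Unset Strict Implicit.
Unset Printing Implicit Defensive.

Local Open Scope classical_set_scope.
Local Open Scope ring_scope.

(** * Euclidean inner product, norm and dyads *)

Section EuclideanVectors.
Context {R : realType} {d : nat}.
Implicit Types (u v w : 'cV[R]_d) (S P : 'M[R]_d) (a b t : R).

Lemma dotvE u v : dotv u v = \sum_i u i 0 * v i 0.
Proof. by rewrite /dotv mxE; apply: eq_bigr => i _; rewrite mxE. Qed.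

Lemma dotvC u v : dotv u v = dotv v u.
Proof. by rewrite !dotvE; apply: eq_bigr => i _; rewrite mulrC. Qed.

Lemma dotvDr u v w : dotv u (v + w) = dotv u v + dotv u w.
Proof. by rewrite /dotv mulmxDr mxE. Qed.

Lemma dotvDl u v w : dotv (u + v) w = dotv u w + dotv v w.
Proof. by rewrite dotvC dotvDr !(dotvC w). Qed.

Lemma dotvZr a u v : dotv u (a *: v) = a * dotv u v.
Proof. by rewrite /dotv -scalemxAr mxE. Qed.

Lemma dotvZl a u v : dotv (a *: u) v = a * dotv u v.
Proof. by rewrite dotvC dotvZr dotvC. Qed.

Lemma dotvNr u v : dotv u (- v) = - dotv u v.
Proof. by rewrite -scaleN1r dotvZr mulN1r. Qed.

Lemma dotvBr u v w : dotv u (v - w) = dotv u v - dotv u w.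
Proof. by rewrite dotvDr dotvNr. Qed.

Lemma dotvBl u v w : dotv (u - v) w = dotv u w - dotv v w.
Proof. by rewrite dotvC dotvBr !(dotvC w). Qed.

Lemma dotv0r u : dotv u 0 = 0.
Proof. by rewrite /dotv mulmx0 mxE. Qed.

Lemma dotv0l u : dotv 0 u = 0.
Proof. by rewrite dotvC dotv0r. Qed.

Lemma dotvv_ge0 u : 0 <= dotv u u.
Proof. by rewrite dotvE sumr_ge0 // => i _; rewrite -expr2 sqr_ge0. Qed.

Lemma dotvv_eq0 u : (dotv u u == 0) = (u == 0).
Proof.
apply/eqP/eqP => [u0|->]; last exact: dotv0l.
apply/matrixP => i j; rewrite ord1 mxE; apply/eqP.
rewrite -sqrf_eq0 expr2; apply/eqP.
move: u0; rewrite dotvE => /psumr_eq0P; apply=> // k _.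
by rewrite -expr2 sqr_ge0.
Qed.

Lemma dotvv_gt0 u : (0 < dotv u u) = (u != 0).
Proof. by rewrite lt_def dotvv_ge0 andbT dotvv_eq0. Qed.

Lemma norm2_ge0 u : 0 <= norm2 u.
Proof. exact: sqrtr_ge0. Qed.

Lemma norm2_sqr u : norm2 u ^+ 2 = dotv u u.
Proof.
rewrite /norm2 sqr_sqrtr; last by apply: sumr_ge0 => i _; exact: sqr_ge0.
by rewrite dotvE; apply: eq_bigr => i _; rewrite expr2.
Qed.

Lemma norm2_0 : norm2 (0 : 'cV[R]_d) = 0.
Proof. by apply/eqP; rewrite -sqrf_eq0 norm2_sqr dotv0l. Qed.

Lemma norm2_gt0 u : (0 < norm2 u) = (u != 0).
Proof. by rewrite lt_def norm2_ge0 andbT -sqrf_eq0 norm2_sqr dotvv_eq0. Qed.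

Lemma quadfE S u : quadf S u = dotv u (S *m u).
Proof. by rewrite /quadf /dotv mulmxA. Qed.

Lemma dyad_mul u v w : u *m v^T *m w = dotv v w *: u.
Proof.
by rewrite -mulmxA [X in u *m X]mx11_scalar mul_mx_scalar.
Qed.

Lemma dyad_tr u v : (u *m v^T)^T = v *m u^T.
Proof. by rewrite trmx_mul trmxK. Qed.

Lemma mxtrace_dyad u v : \tr (u *m v^T) = dotv u v.
Proof. by rewrite mxtrace_mulC /mxtrace big_ord1 -/(dotv v u) dotvC. Qed.

End EuclideanVectors.

Lemma dotv_mulmx {R : realType} {m n : nat} (A : 'M[R]_(m, n)) u v :
  dotv (A *m u) v = dotv u (A^T *m v).
Proof. by rewrite /dotv trmx_mul mulmxA. Qed.

(** Discriminant argument: the quadratic is evaluated at its minimizer [- b / c], and for [c = 0] an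
    affine function bounded below has slope zero. *)
Lemma sqr_le_of_quadratic_ge0 {R : realType} (a b c : R) :
  0 <= c -> (forall t, 0 <= a + 2 * t * b + t ^+ 2 * c) -> b ^+ 2 <= a * c.
Proof.
move=> c_ge0 h.
have [c0|c0] := eqVneq c 0.
  rewrite c0 mulr0; have [->|b0] := eqVneq b 0; first by rewrite expr0n.
  (* At this point the affine function takes the value -1. *)
  have := h (- (a + 1) / (2 * b)); rewrite c0 mulr0 addr0.
  have -> : a + 2 * (- (a + 1) / (2 * b)) * b = - 1 by field.
  by rewrite oppr_ge0 ler10.
have cpos : 0 < c by rewrite lt_def c0.
have := h (- b / c).
have -> : a + 2 * (- b / c) * b + (- b / c) ^+ 2 * c = a - b ^+ 2 / c by field.
by rewrite subr_ge0 ler_pdivrMr.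
Qed.

(** * Positive semidefinite matrices: Cauchy-Schwarz, eigenvectors, square roots *)

Section PositiveSemidefinite.
Context {R : realType} {d : nat}.
Implicit Types (u v w x : 'cV[R]_d) (S P B C D : 'M[R]_d) (a b t : R).

Lemma dotv_sym S u v : S^T = S -> dotv (S *m u) v = dotv u (S *m v).
Proof. by move=> St; rewrite dotv_mulmx St. Qed.

Lemma psd_cauchy_schwarz S u v :
  is_psd S -> dotv u (S *m v) ^+ 2 <= quadf S u * quadf S v.
Proof.
move=> [St S0]; apply: sqr_le_of_quadratic_ge0 => // t.
have := S0 (u + t *: v); rewrite !quadfE mulmxDr -scalemxAr.
rewrite !(dotvDl, dotvDr, dotvZl, dotvZr) -(dotv_sym v u St) (dotvC (S *m v)).
by move=> h; apply: le_trans h _; rewrite le_eqVlt; apply/orP; left; apply/eqP; ring.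
Qed.

Lemma psd1 : is_psd (1%:M : 'M[R]_d).
Proof.
by split=> [|v]; rewrite ?trmx1 // quadfE mul1mx dotvv_ge0.
Qed.

Lemma cauchy_schwarz u v : dotv u v ^+ 2 <= dotv u u * dotv v v.
Proof. by have := psd_cauchy_schwarz u v psd1; rewrite !quadfE !mul1mx. Qed.

(** Reverse triangle inequality for the seminorm [sqrt (quadf S)]; after expansion it is
    Cauchy-Schwarz. *)
Lemma psd_sqrt_quadf_triangle S u v : is_psd S ->
  (Num.sqrt (quadf S u) - Num.sqrt (quadf S v)) ^+ 2 <= quadf S (u - v).
Proof.
move=> Spsd; have [St S0] := Spsd.
have h : dotv u (S *m v) <= Num.sqrt (quadf S u) * Num.sqrt (quadf S v).
  rewrite -sqrtrM // (le_trans (ler_norm _)) // -sqrtr_sqr.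
  exact/ler_wsqrtr/psd_cauchy_schwarz.
have -> : quadf S (u - v) = quadf S u + quadf S v - 2 * dotv u (S *m v).
  rewrite !quadfE mulmxBr !(dotvBl, dotvBr) -(dotv_sym v u St).
  by rewrite (dotvC (S *m v)); ring.
rewrite sqrrB !sqr_sqrtr //; lra.
Qed.

(** Cauchy-Schwarz for the pair [S v], [v] bounds the fourth power of the norm of [S v] by a
    multiple of [quadf S v]. *)
Lemma psd_quadf_eq0 S v : is_psd S -> quadf S v = 0 -> S *m v = 0.
Proof.
move=> Spsd q0; apply/eqP; rewrite -dotvv_eq0 -sqrf_eq0.
rewrite eq_le sqr_ge0 andbT.
by have := psd_cauchy_schwarz (S *m v) v Spsd; rewrite q0 mulr0.
Qed.

Lemma quadf_trmul (N : 'M[R]_d) x : quadf (N^T *m N) x = dotv (N *m x) (N *m x).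
Proof. by rewrite quadfE dotv_mulmx mulmxA. Qed.

Lemma psd_trmul (N : 'M[R]_d) : is_psd (N^T *m N).
Proof.
by split=> [|v]; [rewrite trmx_mul trmxK|rewrite quadf_trmul dotvv_ge0].
Qed.

Lemma mxtrace_trmul (N : 'M[R]_d) :
  \tr (N^T *m N) = \sum_i \sum_j N i j ^+ 2.
Proof.
rewrite exchange_big; apply: eq_bigr => i _; rewrite mxE.
by apply: eq_bigr => j _; rewrite mxE expr2.
Qed.

Lemma mxtrace_trmul_ge0 (N : 'M[R]_d) : 0 <= \tr (N^T *m N).
Proof.
by rewrite mxtrace_trmul; do 2!apply: sumr_ge0 => ? _; exact: sqr_ge0.
Qed.

Lemma mxtrace_trmul_eq0 (N : 'M[R]_d) : \tr (N^T *m N) = 0 -> N = 0.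
Proof.
rewrite mxtrace_trmul => /psumr_eq0P h; apply/matrixP => i j.
have /psumr_eq0P := h (fun i _ => sumr_ge0 _ (fun j _ => sqr_ge0 (N i j))) i isT.
by move=> /(_ (fun j _ => sqr_ge0 (N i j)) j isT)/eqP; rewrite sqrf_eq0 mxE => /eqP.
Qed.

(** The operator norm is at most the Frobenius norm: Cauchy-Schwarz on each row of [N]. *)
Lemma dotv_mulmx_le_trace (N : 'M[R]_d) x :
  dotv (N *m x) (N *m x) <= \tr (N^T *m N) * dotv x x.
Proof.
rewrite mxtrace_trmul dotvE mulr_suml; apply: ler_sum => i _.
have := cauchy_schwarz (row i N)^T x.
have -> : dotv (row i N)^T x = (N *m x) i 0.
  by rewrite dotvE mxE; apply: eq_bigr => j _; rewrite !mxE.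
rewrite -expr2 => /le_trans; apply; rewrite le_eqVlt dotvE.
apply/orP; left; apply/eqP; congr (_ * _).
by apply: eq_bigr => j _; rewrite !mxE expr2.
Qed.

Lemma continuous_quadf_tr S : continuous (fun x : 'rV[R]_d => quadf S x^T).
Proof.
rewrite (_ : (fun _ => _) =
    fun x : 'rV_d => \sum_i \sum_j x 0 i * (S i j * x 0 j)); last first.
  apply/funext => x; rewrite quadfE dotvE; apply: eq_bigr => i _.
  by rewrite !mxE mulr_sumr; apply: eq_bigr => j _; rewrite !mxE.
have cc i : continuous (fun x : 'rV[R]_d => x 0 i) by exact: coord_continuous.
have ca : continuous (fun x : R * R => x.1 + x.2) by exact: add_continuous.
apply: continuous_big => // i _; apply: continuous_big => // j _ x.
have cM (f g : 'rV[R]_d -> R) : {for x, continuous f} -> {for x, continuous g} ->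
  {for x, continuous (fun y : 'rV[R]_d => f y * g y : R)} by exact: continuousM.
by apply: (cM _ _ (cc i x)); apply: (cM _ _ _ (cc j x)); exact: cst_continuous.
Qed.

Lemma compact_unit_sphere :
  compact [set x : 'rV[R]_d | dotv x^T x^T = 1].
Proof.
have -> : [set x : 'rV[R]_d | dotv x^T x^T = 1] =
    (fun x : 'rV[R]_d => quadf 1%:M x^T) @^-1` [set 1].
  by apply/seteqP; split=> x /=; rewrite quadfE mul1mx.
apply: bounded_closed_compact; last first.
  by apply: closed_comp; [move=> x _; exact: continuous_quadf_tr|exact: closed_eq].
(* Boundedness is in the sup norm: each squared coordinate is a summand of the squared Euclidean
   norm, which is 1. *)
exists 1; split=> // M M1 x /=; rewrite quadfE mul1mx dotvE => x1.
apply: le_trans (ltW M1); rewrite [leLHS]/Num.norm /= mx_normrE.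
apply/bigmax_leP; split=> //= -[i j] _ /=; rewrite ord1.
rewrite -(@ler_pXn2r _ 2) ?nnegrE // expr1n real_normK ?num_real // -x1.
rewrite (bigD1 j) //= !mxE -expr2 lerDl.
by apply: sumr_ge0 => k _; rewrite mxE -expr2 sqr_ge0.
Qed.

(** A maximizer of the quadratic form on the unit sphere is an eigenvector: with [l] the maximum,
    [l I - S] is positive semidefinite and its form vanishes at the maximizer, hence so does its
    action. *)
Lemma psd_top_eigenvector S : is_psd S -> S != 0 ->
  exists v l, [/\ 0 < l, dotv v v = 1 & S *m v = l *: v].
Proof.
move=> [St S0] Snz.
have normalize w : w != 0 ->
    exists a, dotv (a *: w) (a *: w) = 1 /\ quadf S w = a ^- 2 * quadf S (a *: w).
  move=> w0; exists (norm2 w)^-1; rewrite !quadfE -scalemxAr !dotvZl !dotvZr.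
  have n0 : norm2 w != 0 by rewrite gt_eqF // norm2_gt0.
  by rewrite -norm2_sqr; split; field.
have [w w0] : exists w, quadf S w != 0.
  apply: contrapT => /forallNP h; move/negP: Snz; apply; apply/eqP.
  apply/matrixP => i j; have /psd_quadf_eq0 : is_psd S by split.
  move=> /(_ (delta_mx j 0)); rewrite -colE => /(_ _)/matrixP/(_ i 0).
  rewrite !mxE; apply.
  by have /negP := h (delta_mx j 0); rewrite negbK => /eqP.
have wn0 : w != 0 by apply: contraNneq w0 => ->; rewrite quadfE dotv0l.
have [a [a1 qa]] := normalize w wn0.
have [|c] := EVT_max_rV _ compact_unit_sphere
  (continuous_subspaceT (@continuous_quadf_tr S)).
  by exists (a *: w)^T; rewrite /= trmxK.
rewrite inE /= => c1 cmax; pose l := quadf S c^T.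
have le_l u : quadf S u <= l * dotv u u.
  have [->|u0] := eqVneq u 0; first by rewrite quadfE !dotv0l mulr0.
  have [b [b1 ->]] := normalize u u0.
  have -> : dotv u u = b ^- 2.
    move: b1; rewrite dotvZl dotvZr mulrA -expr2 => b1.
    have b0 : b ^+ 2 != 0.
      by apply: contra_eq_neq b1 => ->; rewrite mul0r eq_sym oner_neq0.
    by rewrite -[RHS]mulr1 -b1 mulKf.
  rewrite mulrC ler_pM2r.
    by have := cmax (b *: u)^T; rewrite inE /= trmxK; apply.
  rewrite lt_neqAle invr_ge0 sqr_ge0 andbT eq_sym invr_eq0 sqrf_eq0.
  by apply: contra_eq_neq b1 => ->; rewrite scale0r dotv0l eq_sym oner_neq0.
have l0 : 0 < l.
  have := le_l w; have := S0 w; move: w0; rewrite -dotvv_gt0 in wn0.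
  by rewrite neq_lt => /orP[|q0 _ ql]; [lra|rewrite -(pmulr_lgt0 _ wn0); lra].
exists c^T, l; split => //.
have psdl : is_psd (l%:M - S).
  split=> [|u]; first by rewrite linearB /= tr_scalar_mx St.
  by rewrite quadfE mulmxBl mul_scalar_mx dotvBr dotvZr -quadfE subr_ge0.
apply/eqP; rewrite eq_sym -subr_eq0 -mul_scalar_mx -mulmxBl; apply/eqP.
apply: (psd_quadf_eq0 psdl); rewrite quadfE mulmxBl mul_scalar_mx dotvBr dotvZr.
by rewrite -quadfE c1 mulr1 subrr.
Qed.

(** The form of the deflated matrix at [w] is the form of [S] at [w] minus its component along
    [v]. *)
Lemma psd_dyad_sub S v l : is_psd S -> 0 < l -> dotv v v = 1 ->
  S *m v = l *: v -> is_psd (S - l *: (v *m v^T)).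
Proof.
move=> [St S0] l0 v1 Sv; split=> [|w].
  by rewrite linearB /= linearZ /= dyad_tr St.
have := S0 (w - dotv v w *: v).
rewrite !quadfE mulmxBl mulmxBr -scalemxAr -scalemxAl dyad_mul Sv.
rewrite !(dotvBl, dotvBr, dotvZl, dotvZr) v1 -(dotv_sym v w St) Sv dotvZl.
by rewrite (dotvC w v); set a := dotv v w; set b := dotv w _; nra.
Qed.

(** Induction on the rank: an eigenpair [v], [l] is split off, and [sqrt l] times the dyad of [v] is
    added to the root of the remainder. *)
Lemma psd_sqrt_exists S : is_psd S -> exists B, is_psd B /\ B *m B = S.
Proof.
have [n] := ubnP (\rank S); elim: n S => // n IHn S rS Spsd.
have [->|Snz] := eqVneq S 0.
  exists 0; rewrite mul0mx; split=> //; split=> [|v]; first by rewrite trmx0.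
  by rewrite quadfE mul0mx dotv0r.
have [v [l [l0 v1 Sv]]] := psd_top_eigenvector Spsd Snz.
have [St _] := Spsd.
pose S' := S - l *: (v *m v^T).
have S'psd : is_psd S' by exact: psd_dyad_sub.
have S'v : S' *m v = 0.
  by rewrite mulmxBl -scalemxAl dyad_mul v1 scale1r Sv subrr.
have vS : v^T *m S = l *: v^T by rewrite -[LHS]trmxK trmx_mul trmxK St Sv linearZ.
(* The row space of [S'] lies in that of [S], strictly because [S'] kills [v] and [S] does not. *)
have lt_rank : (\rank S' < \rank S)%N.
  apply: rank_ltmx; rewrite ltmxE; apply/andP; split.
    have -> : S' = (1%:M - v *m v^T) *m S.
      by rewrite mulmxBl mul1mx -mulmxA vS -scalemxAr.
    exact: submxMl.
  apply/negP => /submxP [Y SY]; have /eqP := Sv.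
  rewrite SY -mulmxA S'v mulmx0 eq_sym scaler_eq0 gt_eqF //=.
  by move=> /eqP v0; move: v1; rewrite v0 dotv0l => /eqP; rewrite eq_sym oner_eq0.
have [B' [B'psd B'S']] := IHn S' (leq_trans lt_rank (ltnSE rS)) S'psd.
have [B't B'0] := B'psd.
(* Since [B'] squares to [S'], it also kills [v], so the cross terms of the final square vanish. *)
have B'v : B' *m v = 0.
  apply/eqP; rewrite -dotvv_eq0 (dotv_sym _ _ B't) mulmxA B'S' S'v.
  by rewrite dotv0r.
have vB' : v^T *m B' = 0 by rewrite -[LHS]trmxK trmx_mul trmxK B't B'v trmx0.
have sq0 : 0 <= Num.sqrt l by exact: sqrtr_ge0.
exists (B' + Num.sqrt l *: (v *m v^T)); split.
  split=> [|w]; first by rewrite linearD /= linearZ /= dyad_tr B't.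
  rewrite quadfE mulmxDl -scalemxAl dyad_mul dotvDr !dotvZr (dotvC w v).
  by rewrite addr_ge0 -?quadfE // mulr_ge0 // -expr2 sqr_ge0.
rewrite mulmxDl !mulmxDr -!scalemxAl -!scalemxAr.
rewrite mulmxA B'v mul0mx scaler0 addr0 -mulmxA vB' mulmx0 scaler0 add0r.
rewrite [v *m v^T *m _]mulmxA dyad_mul v1 scale1r scalerA -expr2 sqr_sqrtr ?ltW //.
by rewrite B'S' subrK.
Qed.

Lemma psd_factor S : is_psd S -> exists N : 'M[R]_d, S = N^T *m N.
Proof. by move=> /psd_sqrt_exists[B [[Bt _] <-]]; exists B; rewrite Bt. Qed.

(* With D = B - C, the identity D (B + C) = - (B + C) D coming from B^2 = C^2
   makes the trace of the psd matrix D (B + C) D equal to its opposite. *)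
Lemma psd_sqrt_unique B C : is_psd B -> is_psd C -> B *m B = C *m C -> B = C.
Proof.
move=> Bpsd Cpsd BC; have [Bt _] := Bpsd; have [Ct _] := Cpsd.
have [M BM] := psd_factor Bpsd; have [N CN] := psd_factor Cpsd.
pose D := B - C; have Dt : D^T = D by rewrite linearB /= Bt Ct.
have anti : D *m (B + C) = - ((B + C) *m D).
  rewrite /D !(mulmxDl, mulmxDr, mulNmx, mulmxN) BC.
  move: (C *m C) (B *m C) (C *m B) => X Y Z.
  by apply/matrixP => i j; rewrite !mxE; ring.
have tr0 : \tr ((M *m D)^T *m (M *m D)) + \tr ((N *m D)^T *m (N *m D)) = 0.
  have e : (M *m D)^T *m (M *m D) + (N *m D)^T *m (N *m D) = D *m (B + C) *m D.
    rewrite !trmx_mul Dt BM CN; move: (D) => E.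
    by rewrite mulmxDr mulmxDl !mulmxA.
  rewrite -mxtraceD e; set t := \tr _.
  have : t = - t.
    rewrite {1}/t anti mulNmx linearN /= -mulmxA mxtrace_mulC -mulmxA.
    by rewrite mxtrace_mulC.
  lra.
have M0 := mxtrace_trmul_ge0 (M *m D); have N0 := mxtrace_trmul_ge0 (N *m D).
have MD : M *m D = 0 by apply: mxtrace_trmul_eq0; lra.
have ND : N *m D = 0 by apply: mxtrace_trmul_eq0; lra.
(* [D^T D = B D - C D], and both terms vanish by [MD] and [ND]. *)
apply/eqP; rewrite -subr_eq0 -/D; apply/eqP/mxtrace_trmul_eq0.
rewrite Dt {1}/D mulmxBl {1}BM {1}CN -!mulmxA MD ND !mulmx0 subrr.
by rewrite mxtrace0.
Qed.

Lemma psd_sqrtP S :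
  is_psd S -> is_psd (psd_sqrt S) /\ psd_sqrt S *m psd_sqrt S = S.
Proof.
move=> Spsd; have [B hB] := psd_sqrt_exists Spsd.
by rewrite /psd_sqrt; case: xgetP => [C _ //|/(_ B)].
Qed.

Lemma psd_sqrt_eq S B : is_psd B -> B *m B = S -> psd_sqrt S = B.
Proof.
move=> Bpsd BS.
have Spsd : is_psd S by case: (Bpsd) => Bt _; rewrite -BS -{1}Bt; exact: psd_trmul.
have [Cpsd CS] := psd_sqrtP Spsd.
by apply: psd_sqrt_unique => //; rewrite CS.
Qed.

Lemma psd_of_pd S : is_pd S -> is_psd S.
Proof.
move=> [St S0]; split=> // v; have [->|/S0/ltW//] := eqVneq v 0.
by rewrite quadfE dotv0l.
Qed.

Lemma pd_unitmx S : is_pd S -> S \in unitmx.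
Proof.
move=> [St S0]; rewrite -row_free_unit -kermx_eq0; apply/negPn/negP.
case/rowV0Pn=> u /sub_kermxP uS u0.
have ut0 : u^T != 0 by rewrite -trmx0 (inj_eq trmx_inj).
by have := S0 _ ut0; rewrite /quadf trmxK uS mul0mx mxE ltxx.
Qed.

End PositiveSemidefinite.

(** * The Gelbrich ball and its projection along a direction *)

Section Gelbrich.
Context {R : realType} {d : nat}.
Implicit Types (th thh x : 'cV[R]_d) (S A : 'M[R]_d).

(** Cyclicity of the trace brings every cross term to [\tr (B A B)]; the right-hand side, a squared
    Frobenius norm, is the transport cost of the map [A]. *)
Lemma bures_trace (A B : 'M[R]_d) : A^T = A -> B^T = B ->
  \tr (A *m (B *m B) *m A + B *m B - 2 *: (B *m A *m B)) =
  \tr ((B *m (A - 1%:M))^T *m (B *m (A - 1%:M))).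
Proof.
move=> At Bt.
have AIt : (A - 1%:M)^T = A - 1%:M by rewrite linearB /= At trmx1.
rewrite trmx_mul AIt Bt.
rewrite mulmxBl !mulmxBr !mulmxBl !mulmx1 !mul1mx.
rewrite !opprD opprK !mxtraceD !raddfN /= mxtraceZ !mulmxA.
have -> : \tr (A *m B *m B) = \tr (B *m A *m B) by rewrite mxtrace_mulC mulmxA.
have -> : \tr (B *m B *m A) = \tr (B *m A *m B) by rewrite -mulmxA mxtrace_mulC.
by ring.
Qed.

(* [A] is the optimal transport map between the centred Gaussians with
   covariances [Sh] and [A Sh A]. *)
Lemma gelbrich_transport th A thh Sh : is_psd Sh -> is_psd A ->
  gelbrich th (A *m Sh *m A) thh Sh =
  Num.sqrt (norm2 (th - thh) ^+ 2 +
    \tr ((psd_sqrt Sh *m (A - 1%:M))^T *m (psd_sqrt Sh *m (A - 1%:M)))).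
Proof.
move=> Shpsd [At A0]; have [[Bt B0] BB] := psd_sqrtP Shpsd.
rewrite /gelbrich; congr (Num.sqrt (_ + _)).
rewrite -bures_trace // BB; set B := psd_sqrt Sh in Bt B0 BB *.
(* As [Sh = B B], the matrix under the root is the square of [B A B]. *)
rewrite (@psd_sqrt_eq _ _ _ (B *m A *m B)) //; last first.
  by rewrite -[in RHS]BB !mulmxA.
split=> [|v]; first by rewrite !trmx_mul At Bt !mulmxA.
by rewrite quadfE -!mulmxA -(dotv_sym _ _ Bt) -quadfE.
Qed.

(** With [Sh = B B], the equation becomes [(B A B)^2 = B S B]; definiteness of [Sh] makes [B]
    invertible, so [A] can be solved for. *)
Lemma pd_transport_exists S Sh : is_psd S -> is_pd Sh ->
  exists2 A, is_psd A & S = A *m Sh *m A.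
Proof.
move=> Spsd Shpd; have Shpsd := psd_of_pd Shpd.
have [[Bt B0] BB] := psd_sqrtP Shpsd; set B := psd_sqrt Sh in Bt B0 BB *.
have Bu : B \in unitmx.
  by have := pd_unitmx Shpd; rewrite -BB unitmx_mul => /andP[].
have [St S0] := Spsd.
have BSBpsd : is_psd (B *m S *m B).
  split=> [|v]; first by rewrite !trmx_mul St Bt !mulmxA.
  by rewrite quadfE -!mulmxA -(dotv_sym _ _ Bt) -quadfE.
have [[Ct C0] CC] := psd_sqrtP BSBpsd.
set C := psd_sqrt _ in Ct C0 CC *.
have iBt : (invmx B)^T = invmx B by rewrite trmx_inv Bt.
exists (invmx B *m C *m invmx B).
  split=> [|v]; first by rewrite !trmx_mul Ct iBt !mulmxA.
  by rewrite quadfE -!mulmxA -(dotv_sym _ _ iBt) -quadfE.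
rewrite -BB -!mulmxA (mulKVmx Bu) (mulKmx Bu) (mulmxA C C) CC.
by rewrite -!mulmxA (mulKmx Bu) mulmxV // mulmx1.
Qed.

(** Cauchy-Schwarz bounds the mean term. For the other, [sqrt (quadf S x)] is the [Sh]-seminorm of
    [A x], and the reverse triangle inequality leaves that of [A x - x], bounded by the Frobenius
    norm of [N] times the norm of [x]. *)
Lemma gelbrich_projection th S thh Sh rho x :
  is_psd S -> is_pd Sh -> gelbrich th S thh Sh <= rho ->
  (dotv th x - dotv thh x) ^+ 2 +
    (Num.sqrt (quadf S x) - Num.sqrt (quadf Sh x)) ^+ 2 <=
  (rho * norm2 x) ^+ 2.
Proof.
move=> Spsd Shpd; have Shpsd := psd_of_pd Shpd.
have [A Apsd ->] := pd_transport_exists Spsd Shpd; have [At _] := Apsd.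
rewrite gelbrich_transport //; set N := _ *m (A - _).
have T0 := mxtrace_trmul_ge0 N; have n0 := sqr_ge0 (norm2 (th - thh)).
move=> le_rho; have rho0 : 0 <= rho by exact: le_trans (sqrtr_ge0 _) le_rho.
have {le_rho} : norm2 (th - thh) ^+ 2 + \tr (N^T *m N) <= rho ^+ 2.
  by rewrite -[leLHS]sqr_sqrtr ?addr_ge0 // ler_pXn2r ?nnegrE.
rewrite norm2_sqr exprMn norm2_sqr => le_rho.
have CS := cauchy_schwarz (th - thh) x; rewrite dotvBl in CS.
have := dotv_mulmx_le_trace N x; rewrite -quadf_trmul.
have [[Bt _] BB] := psd_sqrtP Shpsd.
have NN : quadf (N^T *m N) x = quadf Sh (A *m x - x).
  rewrite quadf_trmul /N -!mulmxA mulmxBl mul1mx.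
  by rewrite (dotv_sym _ _ Bt) mulmxA BB -quadfE.
have -> : quadf (A *m Sh *m A) x = quadf Sh (A *m x).
  by rewrite !quadfE -!mulmxA (dotv_sym _ _ At).
have := psd_sqrt_quadf_triangle (A *m x) x Shpsd.
rewrite NN => h1 h2; apply: le_trans (ler_wpM2r (dotvv_ge0 x) le_rho).
by rewrite mulrDl lerD // (le_trans h1).
Qed.

(* Moves the nominal mean along [x] and stretches the nominal covariance by
   [A = I + al x x^T]; both moves are optimal for their effect on [x]. *)
Lemma gelbrich_projection_attained thh Sh rho x mu sigma :
  is_pd Sh -> 0 <= rho -> x != 0 -> 0 <= sigma ->
  (mu - dotv thh x) ^+ 2 + (sigma - Num.sqrt (quadf Sh x)) ^+ 2 <=
    (rho * norm2 x) ^+ 2 ->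
  exists th (G : 'M[R]_d), [/\ dotv th x = mu, norm2 (G^T *m x) = sigma &
    gelbrich th (G *m G^T) thh Sh <= rho].
Proof.
move=> Shpd rho0 x0 sigma0; have Shpsd := psd_of_pd Shpd.
have [[Bt _] BB] := psd_sqrtP Shpsd; set B := psd_sqrt Sh in Bt BB *.
have s20 : 0 < quadf Sh x by case: Shpd => _; apply.
set s := Num.sqrt _; have s0 : 0 < s by rewrite sqrtr_gt0.
have ss : quadf Sh x = s ^+ 2 by rewrite sqr_sqrtr ?ltW.
have nn : 0 < dotv x x by rewrite dotvv_gt0.
rewrite exprMn norm2_sqr; set n := dotv x x in nn *; move=> h.
(* Chosen so that [x] is an eigenvector of [A] with eigenvalue [sigma / s]. *)
pose al := (sigma / s - 1) / n.
have nz : n != 0 by rewrite gt_eqF.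
have sz : s != 0 by rewrite gt_eqF.
have aln : 1 + al * n = sigma / s by rewrite /al; field; rewrite nz sz.
pose A : 'M[R]_d := 1%:M + al *: (x *m x^T).
have Ax : A *m x = (sigma / s) *: x.
  by rewrite mulmxDl mul1mx -scalemxAl dyad_mul scalerA -{1}[x]scale1r -scalerDl aln.
have At : A^T = A by rewrite linearD /= linearZ /= dyad_tr trmx1.
have Apsd : is_psd A.
  split=> // v; rewrite quadfE mulmxDl mul1mx -scalemxAl dyad_mul.
  rewrite dotvDr !dotvZr (dotvC v x).
  have := cauchy_schwarz x v; rewrite -/n.
  have := dotvv_ge0 v; have : 0 <= 1 + al * n.
    by rewrite aln divr_ge0 // ltW.
  move: (dotv v v) (dotv x v) => p q; move=> a1 p0 cs.
  (* For negative [al], Cauchy-Schwarz limits the loss, and the eigenvalue [1 + al n] is still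
     nonnegative. *)
  have [al0|/ltW al0] := leP 0 al.
    by rewrite addr_ge0 // mulr_ge0 // -expr2 sqr_ge0.
  have := ler_wnM2l al0 cs; have := mulr_ge0 a1 p0; nra.
exists (thh + ((mu - dotv thh x) / n) *: x), (A *m B).
have -> : A *m B *m (A *m B)^T = A *m Sh *m A.
  by rewrite trmx_mul At Bt -BB !mulmxA.
split.
- by rewrite dotvDl dotvZl -/n divfK // addrC subrK.
- apply/eqP; rewrite -(@eqrXn2 _ 2) ?norm2_ge0 // norm2_sqr; apply/eqP.
  rewrite trmx_mul At Bt -mulmxA Ax -scalemxAr dotvZl dotvZr.
  by rewrite (dotv_sym _ _ Bt) mulmxA BB -quadfE ss; field.
rewrite gelbrich_transport // -/B -[leRHS]ger0_norm // -sqrtr_sqr.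
apply: ler_wsqrtr.
have -> : B *m (A - 1%:M) = al *: (B *m x *m x^T).
  by rewrite /A [X in X - _]addrC addrK -scalemxAr mulmxA.
have -> : \tr ((al *: (B *m x *m x^T))^T *m (al *: (B *m x *m x^T))) =
    (sigma - s) ^+ 2 / n.
  have -> : (al *: (B *m x *m x^T))^T = al *: (x *m (B *m x)^T).
    by rewrite linearZ /= dyad_tr.
  rewrite -scalemxAl -scalemxAr scalerA mxtraceZ.
  rewrite mulmxA dyad_mul -scalemxAl mxtraceZ mxtrace_dyad -/n.
  rewrite (dotv_sym _ _ Bt) mulmxA BB -quadfE ss /al; field.
  by rewrite nz sz.
rewrite [thh + _]addrC addrK norm2_sqr dotvZl dotvZr -/n.
have -> : (mu - dotv thh x) / n * ((mu - dotv thh x) / n * n) =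
  (mu - dotv thh x) ^+ 2 / n by field.
by rewrite -mulrDl ler_pdivrMr.
Qed.

End Gelbrich.

(** * Plane geometry of the tangent from the origin to a disc *)

Section TangentToDisc.
Context {R : realType}.
Implicit Types (m s r mu sigma : R).

(* The sine of the largest polar angle over the disc of radius [r] around
   [(m, s)]. *)
Definition tangent_sine m s r : R :=
  (r * m + s * Num.sqrt (m ^+ 2 + s ^+ 2 - r ^+ 2)) / (m ^+ 2 + s ^+ 2).

(** [(k, h)] is the unit direction of the tangent and [L] its length: the centre [(m, s)] lies at
    distance [r] from the tangent line and projects onto it at distance [L] from the origin. *)
Lemma tangent_to_disc m s r : 0 <= r -> r < m -> 0 < s ->
  let L := Num.sqrt (m ^+ 2 + s ^+ 2 - r ^+ 2) in
  let h := tangent_sine m s r in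
  exists k : R, [/\ 0 < L /\ 0 < h, 0 < k, h ^+ 2 + k ^+ 2 = 1, m * h - s * k = r &
    m * k + s * h = L].
Proof.
move=> r0 rm s0 L h.
have m0 : 0 < m by exact: le_lt_trans r0 rm.
have rm2 : r ^+ 2 < m ^+ 2 by rewrite ltr_pXn2r // nnegrE ltW.
have s20 : 0 < s ^+ 2 by rewrite exprn_gt0.
have D0 : 0 < m ^+ 2 + s ^+ 2 by rewrite addr_gt0 // exprn_gt0.
have L2 : L ^+ 2 = m ^+ 2 + s ^+ 2 - r ^+ 2 by rewrite sqr_sqrtr //; lra.
have L0 : 0 < L by rewrite sqrtr_gt0; lra.
have Dn : m ^+ 2 + s ^+ 2 != 0 by rewrite gt_eqF.
have sL : s < L by rewrite -(@ltr_pXn2r _ 2) ?nnegrE ?ltW // L2; lra.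
(* Obtained by solving the last two equations, linear in [(k, h)]. *)
exists ((m * L - s * r) / (m ^+ 2 + s ^+ 2)); split.
- split=> //; rewrite divr_gt0 //.
  by rewrite ltr_wpDl ?mulr_ge0 ?mulr_gt0 // ltW.
- rewrite divr_gt0 // subr_gt0 mulrC.
  by apply: (le_lt_trans (ler_wpM2r (ltW s0) (ltW rm))); rewrite ltr_pM2l.
- rewrite /h /tangent_sine -/L.
  transitivity ((L ^+ 2 + r ^+ 2) / (m ^+ 2 + s ^+ 2)); first by field.
  by rewrite L2 subrK divff.
- by rewrite /h /tangent_sine -/L; field.
- by rewrite /h /tangent_sine -/L; field.
Qed.

Lemma tangent_sine_itv m s r : 0 <= r -> r < m -> 0 < s ->
  0 < tangent_sine m s r < 1.
Proof.
move=> r0 rm s0; have [k [[_ h0] k0 hk _ _]] := tangent_to_disc r0 rm s0.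
rewrite h0 -(@ltr_pXn2r _ 2) ?nnegrE ?ltW // expr1n -hk ltrDl.
by rewrite exprn_gt0.
Qed.

(** The disc lies in the right half-plane and below the tangent line, so [sigma k <= mu h]; squaring
    and [k^2 = 1 - h^2] give the ratio. *)
Lemma tangent_sine_max m s r mu sigma : 0 <= r -> r < m -> 0 < s -> 0 <= sigma ->
  (mu - m) ^+ 2 + (sigma - s) ^+ 2 <= r ^+ 2 ->
  0 < mu /\ sigma ^+ 2 / (sigma ^+ 2 + mu ^+ 2) <= tangent_sine m s r ^+ 2.
Proof.
move=> r0 rm s0 sigma0 disc.
have mu0 : 0 < mu.
  rewrite ltNge; apply/negP => mu0.
  have : (m - r) ^+ 2 > 0 by rewrite exprn_gt0 // subr_gt0.
  have := sqr_ge0 (sigma - s); nra.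
have [k [[L0 h0] k0 hk mhsk _]] := tangent_to_disc r0 rm s0.
set h := tangent_sine m s r in h0 hk mhsk *.
have le_line : sigma * k <= mu * h.
  suff : - r <= (mu - m) * h - (sigma - s) * k by move: mhsk; lra.
  suff : `|(mu - m) * h - (sigma - s) * k| <= r by rewrite ler_norml => /andP[].
  rewrite -(@ler_pXn2r _ 2) ?nnegrE // real_normK ?num_real //.
  apply: le_trans disc; rewrite -[leRHS]mulr1 -hk.
  (* Lagrange's identity: the defect in Cauchy-Schwarz is a square. *)
  rewrite -subr_ge0 (_ : _ - _ = ((mu - m) * k + (sigma - s) * h) ^+ 2).
    exact: sqr_ge0.
  by ring.
split=> //; rewrite ler_pdivrMr; last first.
  by rewrite ltr_wpDl ?sqr_ge0 // exprn_gt0.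
have : (sigma * k) ^+ 2 <= (mu * h) ^+ 2.
  by rewrite ler_pXn2r // nnegrE mulr_ge0 // ltW.
rewrite [(sigma * k) ^+ 2]exprMn [(mu * h) ^+ 2]exprMn.
by rewrite (_ : k ^+ 2 = 1 - h ^+ 2); [lra|move: hk; lra].
Qed.

(** The witness is the point of contact [(L k, L h)]. The value is put in the form [(1 + t^2)^-1] of
    the two-point law, with [t = mu / sigma]. *)
Lemma tangent_sine_attained m s r : 0 <= r -> r < m -> 0 < s ->
  exists mu sigma : R, [/\ 0 < mu, 0 < sigma,
    (mu - m) ^+ 2 + (sigma - s) ^+ 2 <= r ^+ 2 &
    tangent_sine m s r ^+ 2 = (1 + (mu / sigma) ^+ 2)^-1].
Proof.
move=> r0 rm s0; have [k [[]]] := tangent_to_disc r0 rm s0.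
set L := Num.sqrt _; set h := tangent_sine m s r => L0 h0 k0 hk mhsk mksh.
have L2 : L ^+ 2 = m ^+ 2 + s ^+ 2 - r ^+ 2.
  have m0 := le_lt_trans r0 rm.
  rewrite sqr_sqrtr // subr_ge0 -[leLHS]addr0 lerD ?sqr_ge0 //.
  by rewrite ler_pXn2r ?nnegrE // ltW.
exists (L * k), (L * h); split; [exact: mulr_gt0|exact: mulr_gt0| |].
  have -> : (L * k - m) ^+ 2 + (L * h - s) ^+ 2 =
      L ^+ 2 * (h ^+ 2 + k ^+ 2) - 2 * L * (m * k + s * h) + m ^+ 2 + s ^+ 2.
    by ring.
  have -> : r ^+ 2 = m ^+ 2 + s ^+ 2 - L ^+ 2 by rewrite L2; ring.
  rewrite hk mksh le_eqVlt; apply/orP; left; apply/eqP; ring.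
have hn : h != 0 by rewrite gt_eqF.
have Ln : L != 0 by rewrite gt_eqF.
have -> : 1 + (L * k / (L * h)) ^+ 2 = (h ^+ 2 + k ^+ 2) / h ^+ 2.
  by field; rewrite Ln hn.
by rewrite hk invf_div divr1.
Qed.

End TangentToDisc.

(** * Finitely supported probability measures *)

Definition unit_mass_measure {dsp : measure_display} {T : measurableType dsp}
    {R : realType} (m : {measure set T -> \bar R}) (m1 : m setT = 1%E) :
  set T -> \bar R := m.

HB.instance Definition _ dsp (T : measurableType dsp) (R : realType)
    (m : {measure set T -> \bar R}) (m1 : m setT = 1%E) :=
  Measure.on (unit_mass_measure m1).

(** The alias is indexed by [m1], which supplies the total mass to the structure. *)
HB.instance Definition _ dsp (T : measurableType dsp) (R : realType)
    (m : {measure set T -> \bar R}) (m1 : m setT = 1%E) :=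
  Measure_isProbability.Build _ _ _ (unit_mass_measure m1) m1.

Section FiniteMixture.
Context {dsp : measure_display} {T : measurableType dsp} {R : realType}.

(** Weights are not normalized here, so that induction on the list can add one scaled Dirac mass at
    a time. *)
Lemma dirac_sum_exists {I : Type} (s : seq I) (w : I -> R) (a : I -> T) :
  (forall i, 0 <= w i) ->
  exists m : {measure set T -> \bar R},
    (forall A, m A = (\sum_(i <- s) w i * \1_A (a i))%:E) /\
    (forall f : T -> R, measurable_fun setT f -> (forall t, 0 <= f t) ->
      (\int[m]_t (f t)%:E)%E = (\sum_(i <- s) w i * f (a i))%:E).
Proof.
move=> w0; elim: s => [|i s [m [mA mf]]].
  exists mzero; split=> [A|f mf f0]; rewrite big_nil //.
  by rewrite integral_measure_zero.
pose mi : {measure set T -> \bar R} := mscale (NngNum (w0 i)) \d_(a i).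
exists (measure_add mi m); split=> [A|f mf0 f0].
  transitivity (mi A + m A)%E; first exact: measure_addE.
  by rewrite big_cons EFinD mA.
have /measurable_EFinP mfE := mf0.
rewrite ge0_integral_measure_add //= ?big_cons; last first.
  by move=> t _; rewrite lee_fin.
rewrite ge0_integral_mscale //=; last by move=> t _; rewrite lee_fin.
by rewrite integral_dirac //= diracT mul1e mf // EFinD EFinM.
Qed.

Lemma dirac_mixture_exists {I : finType} (w : I -> R) (a : I -> T) :
  (forall i, 0 <= w i) -> \sum_i w i = 1 ->
  exists P : probability T R,
    (forall A, P A = (\sum_i w i * \1_A (a i))%:E) /\
    (forall f : T -> R, measurable_fun setT f ->
      f \in Lfun P 2%:E /\ expectation P f = (\sum_i w i * f (a i))%:E).
Proof.
move=> w0 w1; have [m [mA mf]] := dirac_sum_exists (index_enum I) a w0.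
have m1 : m setT = 1%E.
  by rewrite mA -[in RHS]w1; congr EFin; apply: eq_bigr => i _; rewrite indicT mulr1.
pose P : probability T R := unit_mass_measure m1.
exists P; split=> [A|f fmeas]; first exact: mA.
have Pf (g : T -> R) : measurable_fun setT g -> (forall t, 0 <= g t) ->
    (\int[P]_t (g t)%:E)%E = (\sum_i w i * g (a i))%:E by exact: mf.
split.
  rewrite inE; apply/andP; split; rewrite inE //=.
  rewrite /finite_norm unlock poweR_lty //=.
  under eq_integral => t _ do rewrite powR_mulrn // real_normK ?num_real //.
  rewrite Pf ?ltry // => [|t]; last exact: sqr_ge0.
  exact: measurable_funX.
rewrite unlock integralE /=.
(* The integral formula covers nonnegative functions, so [f] is split into its positive and negative
   parts. *)
rewrite funerpos funerneg.
rewrite !Pf; last 4 first.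
- exact: measurable_funrneg.
- by move=> t; exact: funrneg_ge0.
- exact: measurable_funrpos.
- by move=> t; exact: funrpos_ge0.
rewrite -EFinB -sumrB; congr EFin; apply: eq_bigr => i _.
by rewrite -mulrBr -[in RHS](funrposBneg f).
Qed.

End FiniteMixture.

(** * Moments of finite linear combinations *)

Section CovarianceOfSums.
Context {dsp : measure_display} {T : measurableType dsp} {R : realType}.
Context (P : probability T R) {I : Type} (X : I -> T -> R) (c : I -> R).
Context (X2 : forall i, X i \in Lfun P 2%:E).

Let lincomb (s : seq I) : T -> R := fun t => \sum_(i <- s) c i * X i t.

Let lincomb_cons i s : lincomb (i :: s) = c i \o* X i \+ lincomb s.
Proof.
by apply/funext => t; rewrite /lincomb big_cons mulrC.
Qed.

Let lincomb_nil : lincomb [::] = cst 0.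
Proof. by apply/funext => t; rewrite /lincomb big_nil. Qed.

Let Lfun1_of_Lfun2 (f : T -> R) : f \in Lfun P 2%:E -> f \in Lfun P 1.
Proof. by apply: Lfun_subset12; exact: fin_num_measure. Qed.

Let term2 i : c i \o* X i \in Lfun P 2%:E.
Proof. by rewrite Lfun_scale // ler1n. Qed.

Lemma Lfun2_lincomb s : lincomb s \in Lfun P 2%:E.
Proof.
elim: s => [|i s IHs]; first by rewrite lincomb_nil Lfun_cst.
by rewrite lincomb_cons rpredD ?lee1n //= => _; exact: term2.
Qed.

Lemma expectation_lincomb s :
  (expectation P (lincomb s) = \sum_(i <- s) (c i)%:E * expectation P (X i))%E.
Proof.
elim: s => [|i s IHs]; first by rewrite lincomb_nil big_nil expectation_cst.
rewrite lincomb_cons big_cons expectationD ?expectationZl ?IHs //.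
- exact: Lfun1_of_Lfun2.
- exact/Lfun1_of_Lfun2/term2.
- exact/Lfun1_of_Lfun2/Lfun2_lincomb.
Qed.

Lemma covariance_lincomb s (Z : T -> R) : Z \in Lfun P 2%:E ->
  (covariance P (lincomb s) Z =
   \sum_(i <- s) (c i)%:E * covariance P (X i) Z)%E.
Proof.
move=> Z2; elim: s => [|i s IHs].
  by rewrite lincomb_nil big_nil covariance_cst_l.
rewrite lincomb_cons big_cons covarianceDl ?Lfun2_lincomb // IHs.
by rewrite covarianceZl ?(Lfun1_of_Lfun2 (X2 i)) ?(Lfun1_of_Lfun2 Z2) //;
  exact: Lfun2_mul_Lfun1.
Qed.

End CovarianceOfSums.

(** * One-dimensional projections of a random vector *)

Section Projections.
Context {R : realType} {d : nat}.
Implicit Types (x th : 'cV[R]_d) (S : 'M[R]_d) (Q : probability (borelV R d) R).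

(** Written as a combination of coordinates so that the moment formulas for linear combinations
    apply. *)
Definition projection x : borelV R d -> R :=
  fun t => \sum_(i < d) x i 0 * coordf i t.

Lemma projectionE x t : projection x t = dotv (t : 'cV[R]_d) x.
Proof. by rewrite dotvE; apply: eq_bigr => i _; rewrite mulrC. Qed.

Lemma measurable_coordf (i : 'I_d) : measurable_fun setT (@coordf R d i).
Proof.
apply: (measurability _ (RGenOpens.measurableE R)).
move=> _ [_ [a [b ->] <-]]; rewrite setTI; apply: sub_sigma_algebra.
have /continuousP : continuous (fun M : 'cV[R]_d => M i 0).
  exact: coord_continuous.
by apply; exact: interval_open.
Qed.

Lemma measurable_projection x : measurable_fun setT (projection x).
Proof.
apply: measurable_sum => i; apply: measurable_funM => //.
exact: measurable_coordf.
Qed.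

Lemma unfavorableE x : unfavorable x = projection x @^-1` `]-oo, 0]%classic.
Proof.
by apply/seteqP; split=> t /=; rewrite /unfavorable /= in_itv /= projectionE.
Qed.

Lemma measurable_unfavorable x : measurable (unfavorable x).
Proof.
by rewrite unfavorableE -[_ @^-1` _]setTI; apply: measurable_projection => //.
Qed.

Section Moments.
Context Q th S (Qmom : has_moments Q th S).

Lemma Lfun2_projection x : projection x \in Lfun Q 2%:E.
Proof. by case: Qmom => L2 _ _; exact: Lfun2_lincomb. Qed.

Lemma expectation_projection x :
  expectation Q (projection x) = (dotv th x)%:E.
Proof.
case: Qmom => L2 EQ _; rewrite expectation_lincomb // dotvE -sumEFin.
by apply: eq_bigr => i _; rewrite EQ -EFinM mulrC.
Qed.

Lemma variance_projection x : variance Q (projection x) = (quadf S x)%:E.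
Proof.
case: Qmom => L2 _ CQ.
rewrite /variance covariance_lincomb //; last exact: Lfun2_projection.
rewrite quadfE dotvE -sumEFin; apply: eq_bigr => i _.
rewrite covarianceC covariance_lincomb // mxE EFinM; congr (_ * _)%E.
rewrite -sumEFin; apply: eq_bigr => j _.
by rewrite covarianceC CQ -EFinM mulrC.
Qed.

(** Positivity is that of the variance of [projection v]. *)
Lemma psd_of_moments : is_psd S.
Proof.
split=> [|v]; last by rewrite -lee_fin -variance_projection variance_ge0.
apply/matrixP => i j; rewrite mxE; case: Qmom => _ _ CQ.
by apply: EFin_inj; rewrite -!CQ covarianceC.
Qed.

Lemma unfavorable_cantelli x : 0 < dotv th x ->
  (Q (unfavorable x) <=
   (quadf S x / (quadf S x + dotv th x ^+ 2))%:E)%E.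
Proof.
move=> mu0; have Y2 := Lfun2_projection x.
have NY2 : (\- projection x) \in Lfun Q 2%:E.
  by rewrite rpredN ?lee1n.
have EN : expectation Q (\- projection x) = (- dotv th x)%:E.
  have -> : \- projection x = -1 \o* projection x.
    by apply/funext => t /=; rewrite mulrN1.
  rewrite expectationZl ?expectation_projection -?EFinM ?mulN1r //.
  by apply: Lfun_subset12 Y2; exact: fin_num_measure.
have NYm := sub_Lfun_mfun NY2.
(* The one-sided bound is applied to the negated projection with deviation equal to the mean:
   exceeding its expectation by [dotv th x] means being nonnegative. *)
have := @cantelli _ _ _ Q (mfun_Sub NYm) (dotv th x) NY2 mu0.
rewrite mfun_valP varianceN // variance_projection /= EN.
apply: le_trans; rewrite le_eqVlt; apply/orP; left; apply/eqP; congr (Q _).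
apply/seteqP; split=> t; rewrite /unfavorable /= -EFinB lee_fin projectionE.
  by rewrite opprK lerDr oppr_ge0.
by rewrite opprK lerDr oppr_ge0.
Qed.

End Moments.
End Projections.

(** * A law with prescribed moments that is two-point along a direction *)

Section TwoPointAlongDirection.
Context {R : realType} {d : nat}.
Implicit Types (x th u g : 'cV[R]_d) (G V : 'M[R]_d).

(** For [g = 0] the inverse of the norm is 0 and [u = 0]; the third identity, unlike unit length,
    survives this case and still makes the dyad of [u] idempotent. *)
Lemma normalized_dyad_idem g :
  let u := (norm2 g)^-1 *: g in
  [/\ norm2 g *: u = g, dotv u g = norm2 g & dotv u u *: u = u].
Proof.
move=> u; have [g0|g0] := eqVneq g 0.
  by rewrite /u g0 !scaler0 !dotv0l norm2_0.
have n0 : norm2 g != 0 by rewrite gt_eqF // norm2_gt0.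
have gu : norm2 g *: u = g by rewrite /u scalerA divff // scale1r.
split=> //; first by rewrite dotvZl -norm2_sqr; field.
by rewrite dotvZl dotvZr -norm2_sqr -[RHS]scale1r; congr (_ *: _); field.
Qed.

(* The random vector is [th + xi *: (G u) + eps *: (sqrt d *: col j V)] with [xi]
   the standardized two-point variable with lower value [- t], [eps] a random
   sign and [j] a uniform index: the second term is orthogonal to [x]. *)
Lemma two_point_projection_exists th G x (t : R) : (0 < d)%N -> 0 < t ->
  dotv th x <= t * norm2 (G^T *m x) ->
  exists Q : probability (borelV R d) R,
    has_moments Q th (G *m G^T) /\ ((1 + t ^+ 2)^-1%:E <= Q (unfavorable x))%E.
Proof.
move=> d0 t0 le_t.
have [] := normalized_dyad_idem (G^T *m x); set u := (_^-1 *: _) => ug dug uu.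
(* The orthogonal projector complementary to [u] splits [G G^T] into [g g^T + V V^T], the second
   part being degenerate along [x]. *)
pose W : 'M[R]_d := 1%:M - u *m u^T.
have Wt : W^T = W by rewrite linearB /= trmx1 dyad_tr.
have WW : W *m W = W.
  rewrite {1}/W mulmxBl mul1mx /W mulmxBr mulmx1 mulmxA dyad_mul.
  by rewrite uu subrr subr0.
pose g := G *m u; pose V := G *m W.
have VV i k : \sum_j V i j * V k j + g i 0 * g k 0 = (G *m G^T) i k.
  have -> : G *m G^T = V *m V^T + g *m g^T.
    rewrite /V /g !trmx_mul Wt mulmxA -(mulmxA G W W) WW.
    rewrite -[G *m u *m _]mulmxA [u *m _]mulmxA mulmxA -mulmxDl -mulmxDr.
    by rewrite subrK mulmx1.
  rewrite !mxE big_ord1 !mxE; congr (_ + _).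
  by apply: eq_bigr => j _; rewrite [V^T _ _]mxE.
have gx : dotv g x = norm2 (G^T *m x) by rewrite dotv_mulmx dug.
have Vx : V^T *m x = 0.
  by rewrite trmx_mul Wt -mulmxA mulmxBl mul1mx dyad_mul dug ug subrr.
clearbody g V.
pose I := (bool * 'I_d * bool)%type.
pose p := (1 + t ^+ 2)^-1.
have tn : t != 0 by rewrite gt_eqF.
have t2 : 0 < 1 + t ^+ 2 by rewrite ltr_pwDl // sqr_ge0.
have t2n : 1 + t ^+ 2 != 0 by rewrite gt_eqF.
have dp : 0 < d%:R :> R by rewrite ltr0n.
have dn : d%:R != 0 :> R by rewrite gt_eqF.
(* Mass [p] for the lower value and [1 - p] for the upper, shared equally among the [d] indices and
   two signs; with values [- t] and [1 / t], this makes [xi] centred with unit variance. *)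
pose wb (b : bool) := (if b then p else 1 - p) / (2 * d%:R).
pose xi (b : bool) : R := if b then - t else t^-1.
pose sd : R := Num.sqrt d%:R.
have sd2 : sd ^+ 2 = d%:R by rewrite sqr_sqrtr // ltW.
pose eps (e : bool) : R := if e then sd else - sd.
pose w (i : I) := wb i.1.1.
pose y (i : I) : 'cV[R]_d := xi i.1.1 *: g + eps i.2 *: col i.1.2 V.
have p01 : 0 < p < 1.
  by rewrite /p invr_gt0 t2 invf_lt1 // ltrDl exprn_gt0.
have w0 i : 0 <= w i.
  case: i => [[[] j] e]; rewrite /w /wb /= divr_ge0 //; try lra;
    by rewrite mulr_ge0 // ltW.
have sumI (F : I -> R) : \sum_i w i * F i =
    \sum_j (p * (F (true, j, true) + F (true, j, false)) +
      (1 - p) * (F (false, j, true) + F (false, j, false))) / (2 * d%:R).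
  transitivity (\sum_(bj : bool * 'I_d) \sum_e w (bj, e) * F (bj, e)).
    by rewrite pair_bigA; apply: eq_bigr => -[].
  transitivity (\sum_b \sum_(j < d) \sum_e w (b, j, e) * F (b, j, e)).
    by rewrite [RHS]pair_bigA; apply: eq_bigr => -[].
  rewrite exchange_big; apply: eq_bigr => j _ /=.
  by rewrite !big_bool /w /wb /=; field.
have sum_const (c : R) : \sum_(j < d) c / d%:R = c.
  by rewrite sumr_const card_ord -[LHS]mulr_natr divfK.
have w1 : \sum_i w i = 1.
  rewrite (eq_bigr (fun i => w i * 1)) => [|i _]; last by rewrite mulr1.
  rewrite sumI -[RHS](sum_const 1); apply: eq_bigr => j _.
  by field.
have [Q [QA Qf]] := @dirac_mixture_exists _ (borelV R d) R _ w
  (fun i => (th + y i : borelV R d)) w0 w1.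
have EQ i : expectation Q (coordf i) = (th i 0)%:E.
  have [_ ->] := Qf _ (@measurable_coordf R d i); congr EFin.
  rewrite sumI -[RHS]sum_const; apply: eq_bigr => j _.
  rewrite /coordf /y !mxE /xi /eps /= /p.
  by field; rewrite dn t2n tn.
exists Q; split; first split => // [i|i k].
- by have [] := Qf _ (@measurable_coordf R d i).
- rewrite unlock !EQ /=.
  set f := (X in expectation Q X).
  have fE v : f v = (coordf i v - th i 0) * (coordf k v - th k 0) by [].
  have mf : measurable_fun setT f.
    by apply: measurable_funM; apply: measurable_funB => //;
      exact: measurable_coordf.
  have [_ ->] := Qf _ mf; congr EFin.
  rewrite -VV -[g i 0 * _]sum_const -big_split sumI; apply: eq_bigr => j _.
  rewrite !fE /coordf /y !mxE /xi /eps /p /=.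
  have sdn : sd != 0 by rewrite -sqrf_eq0 sd2.
  by rewrite -sd2; field; rewrite sdn t2n tn.
rewrite QA lee_fin sumI -/p -[leLHS]sum_const; apply: ler_sum => j _.
(* Every atom with [xi = - t] is unfavorable, whatever the sign and index, and these atoms have
   total mass [p]. *)
have unf e : unfavorable x (th + y (true, j, e)).
  have Vjx : dotv (col j V) x = 0.
    have /matrixP/(_ j 0) := Vx; rewrite !mxE dotvE => Vj.
    by rewrite -[RHS]Vj; apply: eq_bigr => l _; rewrite !mxE.
  rewrite /unfavorable /= dotvDl dotvDl !dotvZl Vjx mulr0 addr0 gx /=.
  by rewrite mulNr subr_le0.
rewrite !indicE !(mem_set (unf _)) /=.
set b1 := (_ \in _); set b2 := (_ \in _).
have -> : p / d%:R = (p * (1 + 1)) / (2 * d%:R) by field.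
have p1 : 0 <= 1 - p by lra.
by rewrite ler_pM2r ?invr_gt0 ?mulr_gt0 // lerDl mulr_ge0 // addr_ge0.
Qed.

End TwoPointAlongDirection.

(** * The worst-case probability of one component *)

Section WorstCaseProbability.
Context {R : realType} {d : nat}.
Context (d_gt0 : (0 < d)%N).
Context (thh : 'cV[R]_d) (Sh : 'M[R]_d) (rho : R).
Context (Shpd : is_pd Sh) (rho_ge0 : 0 <= rho).
Implicit Types x : 'cV[R]_d.

Lemma explicit_ratioE x : explicit_ratio thh Sh rho x =
  tangent_sine (dotv thh x) (Num.sqrt (quadf Sh x)) (rho * norm2 x).
Proof.
have [_ S0] := psd_of_pd Shpd.
by rewrite /explicit_ratio /tangent_sine (sqr_sqrtr (S0 x)) exprMn mulrAC.
Qed.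

Lemma worst_case_prob_le1 x : (worst_case_prob thh Sh rho x <= 1)%E.
Proof.
apply: ge_ereal_sup => _ [Q _ <-].
by apply: probability_le1; exact: measurable_unfavorable.
Qed.

Lemma le_worst_case_prob th (G : 'M[R]_d) x (t : R) : 0 < t ->
  gelbrich th (G *m G^T) thh Sh <= rho ->
  dotv th x <= t * norm2 (G^T *m x) ->
  ((1 + t ^+ 2)^-1%:E <= worst_case_prob thh Sh rho x)%E.
Proof.
move=> t0 th_rho le_t.
have [Q [Qmom le_Q]] := two_point_projection_exists d_gt0 t0 le_t.
apply: le_trans le_Q _; apply: ereal_sup_ubound; exists Q => //.
by exists th, (G *m G^T).
Qed.

(** Some moments in the ball have [dotv th x <= 0], so the two-point bound [(1 + t^2)^-1] holds for
    every [t > 0]; letting [t] tend to 0 gives 1. *)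
Lemma worst_case_prob_eq1 x :
  dotv thh x <= rho * norm2 x -> worst_case_prob thh Sh rho x = 1%E.
Proof.
move=> le_x; apply/eqP; rewrite eq_le worst_case_prob_le1 /=.
have [th [G [th_rho le_thx]]] : exists th (G : 'M[R]_d),
    gelbrich th (G *m G^T) thh Sh <= rho /\ dotv th x <= 0.
  (* For [x = 0] no direction is available, and the nominal moments serve. *)
  have [x0|x0] := eqVneq x 0.
    have [[Bt _] BB] := psd_sqrtP (psd_of_pd Shpd).
    exists thh, (psd_sqrt Sh); rewrite x0 dotv0r Bt BB; split => //.
    have := gelbrich_transport thh thh (psd_of_pd Shpd) psd1.
    rewrite mul1mx mulmx1 => ->; rewrite !subrr mulmx0 trmx0 mul0mx mxtrace0.
    by rewrite norm2_0 expr0n addr0 sqrtr0.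
  (* The leftmost point of the disc. *)
  have disc : (dotv thh x - rho * norm2 x - dotv thh x) ^+ 2 +
      (Num.sqrt (quadf Sh x) - Num.sqrt (quadf Sh x)) ^+ 2 <=
      (rho * norm2 x) ^+ 2.
    by rewrite le_eqVlt; apply/orP; left; apply/eqP; ring.
  have [th [G [thx _ th_rho]]] :=
    gelbrich_projection_attained Shpd rho_ge0 x0 (sqrtr_ge0 _) disc.
  by exists th, G; split; rewrite // thx subr_le0.
(* With [t = sqrt e] the bound is [1 / (1 + e)], at least [1 - e]. *)
apply/lee_addgt0Pr => e e0.
have se : 0 < Num.sqrt e by rewrite sqrtr_gt0.
have := le_worst_case_prob se th_rho
  (le_trans le_thx (mulr_ge0 (ltW se) (norm2_ge0 _))).
rewrite (sqr_sqrtr (ltW e0)) => le_wcp.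
apply: le_trans (leeD2r e%:E le_wcp); rewrite -EFinD lee_fin.
have e1 : 0 < 1 + e by rewrite addr_gt0.
rewrite -subr_ge0 (_ : _ - 1 = e ^+ 2 / (1 + e)).
  by rewrite divr_ge0 ?sqr_ge0 // ltW.
by field; rewrite gt_eqF.
Qed.

Section Feasible.
Context x (x_feas : rho * norm2 x < dotv thh x).

Let x_neq0 : x != 0.
Proof.
by apply: contraTneq x_feas => ->; rewrite norm2_0 dotv0r mulr0 ltxx.
Qed.

Let r_ge0 : 0 <= rho * norm2 x.
Proof. by rewrite mulr_ge0 // norm2_ge0. Qed.

Let s_gt0 : 0 < Num.sqrt (quadf Sh x).
Proof. by rewrite sqrtr_gt0; case: Shpd => _; apply. Qed.

Lemma explicit_ratio_itv : 0 < explicit_ratio thh Sh rho x < 1.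
Proof. by rewrite explicit_ratioE tangent_sine_itv. Qed.

Lemma worst_case_probE :
  worst_case_prob thh Sh rho x = (explicit_ratio thh Sh rho x ^+ 2)%:E.
Proof.
rewrite explicit_ratioE; apply/eqP; rewrite eq_le; apply/andP; split.
  apply: ge_ereal_sup => _ [Q [th [S [Qmom th_rho]]] <-].
  have Spsd := psd_of_moments Qmom; have [_ S0] := Spsd.
  have disc := gelbrich_projection x Spsd Shpd th_rho.
  have [mu0 le_sine] :=
    tangent_sine_max r_ge0 x_feas s_gt0 (sqrtr_ge0 (quadf S x)) disc.
  apply: le_trans (unfavorable_cantelli Qmom mu0) _.
  by rewrite lee_fin; move: le_sine; rewrite sqr_sqrtr.
have [mu [sigma [mu0 sigma0 disc ->]]] :=
  tangent_sine_attained r_ge0 x_feas s_gt0.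
have [th [G [thx Gx th_rho]]] :=
  gelbrich_projection_attained Shpd rho_ge0 x_neq0 (ltW sigma0) disc.
(* With [t = mu / sigma] the mean condition is an equality. *)
apply: le_worst_case_prob th_rho _; first exact: divr_gt0.
by rewrite thx Gx divfK // gt_eqF.
Qed.

End Feasible.

Lemma worst_case_prob_lt1 x :
  (worst_case_prob thh Sh rho x < 1)%E <-> - dotv thh x + rho * norm2 x < 0.
Proof.
rewrite addrC subr_lt0; split=> [wcp1|x_feas].
  by rewrite ltNge; apply/negP => /worst_case_prob_eq1 wcp; rewrite wcp ltxx in wcp1.
rewrite worst_case_probE // lte_fin; have /andP[h0 h1] := explicit_ratio_itv x_feas.
by rewrite expr_lt1 // ltW.
Qed.

End WorstCaseProbability.

(** * Comparison of maxima and equivalence of the two problems *)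

Lemma le_bigmax_EFin {R : realType} {K : nat} (f g : 'I_K -> R) :
  (\big[maxe/-oo%E]_(k < K) (f k)%:E <= \big[maxe/-oo%E]_(k < K) (g k)%:E)%E <->
  forall k, exists j, f k <= g j.
Proof.
split=> [/bigmax_leP[_ h] k|h].
  by have /bigmax_geP[|[j _]] := h k isT; rewrite // lee_fin; exists j.
apply/bigmax_leP; split=> [|k _]; first exact: leNye.
have [j fg] := h k; apply/bigmax_geP; right; exists j => //.
Qed.

Theorem corollaryC3 (R : realType) (d K : nat) (hd : (0 < d)%N) (hK : (0 < K)%N)
    (X : set 'cV[R]_d) (x0 : 'cV[R]_d) (delta : R) (hdelta : 0 <= delta)
    (c : 'cV[R]_d -> 'cV[R]_d -> R)
    (hc0 : forall x y, 0 <= c x y)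
    (hc : continuous (fun p : 'cV[R]_d * 'cV[R]_d => c p.1 p.2))
    (thetah : 'I_K -> 'cV[R]_d) (Sigmah : 'I_K -> 'M[R]_d)
    (hSigmah : forall k, is_pd (Sigmah k))
    (rho : 'I_K -> R) (hrho : forall k, 0 <= rho k) :
  robust_feasible X x0 delta c thetah Sigmah rho =
    explicit_feasible X x0 delta c thetah rho /\
  argmin (robust_feasible X x0 delta c thetah Sigmah rho)
         (robust_objective thetah Sigmah rho) =
    argmin (explicit_feasible X x0 delta c thetah rho)
           (explicit_objective thetah Sigmah rho).
Proof.
have feasE : robust_feasible X x0 delta c thetah Sigmah rho =
    explicit_feasible X x0 delta c thetah rho.
  by apply/seteqP; split=> x [Xx cx kx]; split=> // k; apply/worst_case_prob_lt1.
split=> //; rewrite feasE.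
(* Minimizers depend only on the order that the objective induces on the feasible set. *)
suff le_iff x y : explicit_feasible X x0 delta c thetah rho x ->
    explicit_feasible X x0 delta c thetah rho y ->
    (robust_objective thetah Sigmah rho x <= robust_objective thetah Sigmah rho y)%E
    <-> (explicit_objective thetah Sigmah rho x <=
         explicit_objective thetah Sigmah rho y)%E.
  by apply/seteqP; split=> x [Fx min_x]; split=> // y Fy; apply/le_iff => //;
    exact: min_x.
have feas z k : explicit_feasible X x0 delta c thetah rho z ->
    rho k * norm2 z < dotv (thetah k) z.
  by case=> _ _ /(_ k); rewrite addrC subr_lt0.
have objE z : explicit_feasible X x0 delta c thetah rho z ->
    robust_objective thetah Sigmah rho z = (\big[maxe/-oo]_(k < K)
      (explicit_ratio (thetah k) (Sigmah k) (rho k) z ^+ 2)%:E)%E.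
  by move=> Fz; apply: eq_bigr => k _; rewrite worst_case_probE //; exact: feas.
move=> Fx Fy; rewrite !objE // !le_bigmax_EFin.
(* Comparing maxima reduces to comparing single entries, where squaring preserves order because the
   ratios are positive. *)
have le_sqr k j : explicit_ratio (thetah k) (Sigmah k) (rho k) x ^+ 2 <=
      explicit_ratio (thetah j) (Sigmah j) (rho j) y ^+ 2 =
    (explicit_ratio (thetah k) (Sigmah k) (rho k) x <=
      explicit_ratio (thetah j) (Sigmah j) (rho j) y).
  have /andP[hx _] := explicit_ratio_itv (hSigmah k) (hrho k) (feas _ k Fx).
  have /andP[hy _] := explicit_ratio_itv (hSigmah j) (hrho j) (feas _ j Fy).
  by rewrite ler_pXn2r // nnegrE ltW.
by split=> h k; have [j] := h k; exists j; move: h; rewrite ?le_sqr // -le_sqr.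
Qed.
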